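(* Assume the sharpness condition: there is $\lambda_s>0$ with $F(x)-F(x_\star)\ge\lambda_s\Delta(x)$ for all $x\in\mathbb R^n$. Let $\tilde p\in(0,1)$ with $m\tilde p$ a positive integer, and let $u_L,u_H>0$ be constants such that $r^{\tilde p}(x)\in[u_L(F(x)-F(x_\star)),u_H(F(x)-F(x_\star))]$ for all $x\in\mathbb R^n$. Let $G>0$, $g_L:=G\lambda_su_L$ and $g_H:=\frac32GL\|x_\star\|_2u_H$. Consider AdaIPL (defined in the context) with step sizes $t_k=\min\{L^{-1},G\,r^{\tilde p}(x^k)\}$, whose subproblems are solved by a subproblem solver with constant $C_0\ge2$ (defined in the context). Put $$E(r):=\frac{1}{2L}\Big(\sqrt{L^2\|x_\star\|_2^2+4rL}-L\|x_\star\|_2\Big),\qquad C(\rho):=1-\frac{5\min\{\lambda_sg_L,2\}}{16(1+\rho)},$$ and suppose $\Delta(x^0)\le\min\big\{E\big(\tfrac{\lambda_s^2}{4L}\big),E\big(\tfrac{\lambda_s}{g_HL}\big)\big\}$. Let $B(r):=\frac2m\|A\|_2(\|x_\star\|_2+r)\max_{i\in[m]}\|a_i\|_2$, $M_1:=\sqrt{1.6\,C_0\,m\,B^2(\lambda_s/(4L))}$ and $M_2:=\sqrt{16\,C_0\,m\,B^2(\lambda_s/(4L))}$. Then the total number $N(\epsilon)$ of inner iterations satisfies: (a) If the termination condition is (LAC) for some $\rho_l>0$, then for every $\epsilon\in(0,\Delta(x^0))$, $$N(\epsilon)\le M_1\cdot\frac{\sqrt{\frac{g_H}{\lambda_s\min\{1,\lambda_sg_H/2\}}}\cdot\sqrt{\frac{1+\rho_l}{\rho_l}}\cdot\log\left(\frac{2\Delta(x^0)L\|x_\star\|_2}{\lambda_sC(\rho_l)}\cdot\frac1\epsilon\right)}{\log(1/C(\rho_l))}.$$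 (b) If the termination condition is (HAC) for some $\rho_h\in(0,1/4)$, then with $\bar\rho:=2\rho_h/(1-4\rho_h)$, for every $\epsilon\in(0,\Delta(x^0))$, $$N(\epsilon)\le M_2\cdot\frac{\frac{g_H}{\min\{1,\lambda_sg_H/2\}}\sqrt{\frac{1+\rho_h}{\rho_h}}\cdot\log\left(\frac{2\Delta(x^0)L\|x_\star\|_2}{\lambda_sC(\bar\rho)}\cdot\frac1\epsilon\right)}{\log(1/C(\bar\rho))}.$$
   Context: Setting (robust phase retrieval): $a_1,\dots,a_m\in\mathbb R^n$, $A=[a_1,\dots,a_m]^\top\in\mathbb R^{m\times n}$, $x_\star\in\mathbb R^n$, and $b=(b_i)\in\mathbb R^m$, $b_i\ge0$, with $b_i=\langle a_i,x_\star\rangle^2$ for $i\in\mathcal I_1$ and $b_i$ an arbitrary non-negative number for $i\in\mathcal I_2$, where $\mathcal I_1,\mathcal I_2$ partition $[m]=\{1,\dots,m\}$. Define $F(x)=\frac1m\sum_{i=1}^m|\langle a_i,x\rangle^2-b_i|$, $L=2\|A\|_2^2/m$ ($\|A\|_2$ the spectral norm), $\Delta(x)=\min\{\|x-x_\star\|_2,\|x+x_\star\|_2\}$. Let $r_i(x)=|\langle a_i,x\rangle^2-b_i|$; $r^{\tilde p}(x)$ is the $(m\tilde p)$-th order statistic ($(m\tilde p)$-th smallest value, with multiplicity) of $r_1(x),\dots,r_m(x)$. Subproblem $k$: given $x^k$ and $t_k>0$, let $B_k=\frac2m\mathrm{diag}(Ax^k)A$, $d_k=\frac1m(b-|Ax^k|^2)$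 ($|\cdot|^2$ entrywise), $H_k(z)=\frac1{2t_k}\|z\|_2^2+\|B_kz-d_k\|_1$ for $z\in\mathbb R^n$, and $D_k(\lambda)=-\frac{t_k}2\|B_k^\top\lambda\|_2^2-\lambda^\top d_k$ for $\lambda\in\mathbb R^m$, $\|\lambda\|_\infty\le1$ (the dual of minimizing $H_k$). Subproblem solver with constant $C_0\ge2$: a procedure that for each $k$ generates a sequence $(z^k_j,\lambda^k_j)_{j\ge0}\subset\mathbb R^n\times\mathbb R^m$ with $\sup_j\|\lambda^k_j\|_\infty\le1$ and $H_k(z^k_j)-D_k(\lambda^k_j)\le\frac{t_kC_0m\|B_k\|_2^2}{(j+1)^2}$ for all $j\ge1$. Termination conditions for a pair $(z,\lambda)$: (LAC) with parameter $\rho_l>0$: $H_k(z)-D_k(\lambda)\le\rho_l(H_k(\mathbf 0)-H_k(z))$; (HAC) with parameter $\rho_h\in(0,1/4)$: $H_k(z)-D_k(\lambda)\le\frac{\rho_h}{2t_k}\|z\|_2^2$. AdaIPL: fix one of (LAC), (HAC). From $x^0$, for $k=0,1,\dots$: compute $t_k$; run the solver on subproblem $k$ until the first $j\ge1$ at which $(z^k_j,\lambda^k_j)$ satisfies the chosen condition; call this index $N_k$, and set $x^{k+1}=x^k+z^k_{N_k}$. For $\epsilon>0$, $K_\epsilon=\inf\{k\ge1:\Delta(x^k)\le\epsilon\}$ and $N(\epsilon)=\sum_{k=0}^{K_\epsilon-1}N_k$ (only iterations before $K_\epsilon$ matter). *)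

(* Defs.v *)
From HB Require Import structures.
From mathcomp Require Import all_boot all_order all_algebra.
From mathcomp Require Import all_classical all_reals all_analysis.
Set Implicit Arguments.
Unset Strict Implicit.
Unset Printing Implicit Defensive.
Import Order.TTheory GRing.Theory Num.Theory.
Import numFieldNormedType.Exports.
Local Open Scope classical_set_scope.
Local Open Scope ring_scope.

(* The library norm `|v| on matrices is the sup norm (used below for
   ||lambda||_oo); the l1, l2 and spectral norms are defined here. *)
Definition norm1 (R : realType) n (v : 'cV[R]_n) : R := \sum_(i < n) `|v i 0|.

Definition norm2 (R : realType) n (v : 'cV[R]_n) : R :=
  Num.sqrt (\sum_(i < n) v i 0 ^+ 2).

Definition dotv (R : realType) n (u v : 'cV[R]_n) : R :=
  \sum_(i < n) u i 0 * v i 0.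

Definition specnorm (R : realType) m n (M : 'M[R]_(m, n)) : R :=
  sup [set norm2 (M *m v) | v in [set v : 'cV[R]_n | norm2 v <= 1]].

(* q-th smallest entry, with multiplicity, for 1 <= q <= m *)
Definition order_stat (R : realType) m (q : nat) (r : 'I_m -> R) : R :=
  nth 0 (sort <=%O [seq r i | i <- enum 'I_m]) q.-1.

Definition datavec (R : realType) m n (A : 'M[R]_(m, n)) (i : 'I_m) : 'cV[R]_n :=
  (row i A)^T.

Definition resid (R : realType) m n (A : 'M[R]_(m, n)) (b : 'cV[R]_m)
    (x : 'cV[R]_n) (i : 'I_m) : R :=
  `| dotv (datavec A i) x ^+ 2 - b i 0 |.

Definition Fobj (R : realType) m n (A : 'M[R]_(m, n)) (b : 'cV[R]_m)
    (x : 'cV[R]_n) : R :=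
  m%:R^-1 * \sum_(i < m) resid A b x i.

Definition Lconst (R : realType) m n (A : 'M[R]_(m, n)) : R :=
  2 * specnorm A ^+ 2 / m%:R.

Definition Delta (R : realType) n (xs x : 'cV[R]_n) : R :=
  Num.min (norm2 (x - xs)) (norm2 (x + xs)).

Definition Bmat (R : realType) m n (A : 'M[R]_(m, n)) (x : 'cV[R]_n) :
    'M[R]_(m, n) :=
  (2 / m%:R) *: (diag_mx (A *m x)^T *m A).

Definition dvec (R : realType) m n (A : 'M[R]_(m, n)) (b : 'cV[R]_m)
    (x : 'cV[R]_n) : 'cV[R]_m :=
  m%:R^-1 *: (b - \col_(i < m) `|(A *m x) i 0| ^+ 2).

Definition Hprimal (R : realType) m n (A : 'M[R]_(m, n)) (b : 'cV[R]_m)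
    (x : 'cV[R]_n) (t : R) (z : 'cV[R]_n) : R :=
  1 / (2 * t) * norm2 z ^+ 2 + norm1 (Bmat A x *m z - dvec A b x).

Definition Ddual (R : realType) m n (A : 'M[R]_(m, n)) (b : 'cV[R]_m)
    (x : 'cV[R]_n) (t : R) (lam : 'cV[R]_m) : R :=
  - (t / 2) * norm2 ((Bmat A x)^T *m lam) ^+ 2 - dotv lam (dvec A b x).

Definition solver_output (R : realType) m n (A : 'M[R]_(m, n)) (b : 'cV[R]_m)
    (C0 : R) (x : 'cV[R]_n) (t : R)
    (z : nat -> 'cV[R]_n) (lam : nat -> 'cV[R]_m) : Prop :=
  (forall j, `|lam j| <= 1) /\
  (forall j, (1 <= j)%N ->
     Hprimal A b x t (z j) - Ddual A b x t (lam j)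
       <= t * C0 * m%:R * specnorm (Bmat A x) ^+ 2 / (j.+1)%:R ^+ 2).

(* A termination condition takes the current iterate x^k, the step size t_k
   and a primal-dual pair (z, lambda). *)
Definition term_cond (R : realType) m n : Type :=
  'cV[R]_n -> R -> 'cV[R]_n -> 'cV[R]_m -> Prop.

Definition LAC (R : realType) m n (A : 'M[R]_(m, n)) (b : 'cV[R]_m) (rho : R) :
    term_cond R m n :=
  fun x t z lam =>
    Hprimal A b x t z - Ddual A b x t lam
      <= rho * (Hprimal A b x t 0 - Hprimal A b x t z).

Definition HAC (R : realType) m n (A : 'M[R]_(m, n)) (b : 'cV[R]_m) (rho : R) :
    term_cond R m n :=
  fun x t z lam =>
    Hprimal A b x t z - Ddual A b x t lam <= rho / (2 * t) * norm2 z ^+ 2.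

(* inf {k >= 1 : P k}, equal to +oo when there is no such k *)
Definition first_index (R : realType) (P : nat -> Prop) : \bar R :=
  ereal_inf [set (k%:R)%:E | k in [set k : nat | (1 <= k)%N /\ P k]].

Definition stepsize (R : realType) m n (A : 'M[R]_(m, n)) (b : 'cV[R]_m)
    (q : nat) (G : R) (x : 'cV[R]_n) : R :=
  Num.min (Lconst A)^-1 (G * order_stat q (resid A b x)).

(* N_k; +oo when the inner loop on subproblem k never terminates *)
Definition inner_iters (R : realType) m n (A : 'M[R]_(m, n)) (b : 'cV[R]_m)
    (q : nat) (G : R) (stop : term_cond R m n) (x : nat -> 'cV[R]_n)
    (z : nat -> nat -> 'cV[R]_n) (lam : nat -> nat -> 'cV[R]_m)
    (k : nat) : \bar R :=
  first_index R (fun j => stop (x k) (stepsize A b q G (x k)) (z k j) (lam k j)).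

(* Subproblem k only exists when t_k > 0.  When t_k = 0, or when the inner loop
   does not terminate, x^{k+1} is not prescribed by the algorithm and is left
   unconstrained; in the second case N_k = +oo, so that if k < K_eps the total
   count below is +oo whatever x^{k+1} is. *)
Definition AdaIPL_run (R : realType) m n (A : 'M[R]_(m, n)) (b : 'cV[R]_m)
    (q : nat) (G C0 : R) (stop : term_cond R m n) (x0 : 'cV[R]_n)
    (x : nat -> 'cV[R]_n) (z : nat -> nat -> 'cV[R]_n)
    (lam : nat -> nat -> 'cV[R]_m) : Prop :=
  x 0%N = x0 /\
  (forall k, 0 < stepsize A b q G (x k) ->
     solver_output A b C0 (x k) (stepsize A b q G (x k)) (z k) (lam k) /\
     (forall j : nat,
        inner_iters A b q G stop x z lam k = (j%:R)%:E ->
        x k.+1 = x k + z k j)).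

Definition Keps (R : realType) n (xs : 'cV[R]_n) (x : nat -> 'cV[R]_n)
    (eps : R) : \bar R :=
  first_index R (fun k => Delta xs (x k) <= eps).

(* N(eps), with value +oo if K_eps = +oo or some N_k with k < K_eps is +oo *)
Definition total_inner (R : realType) m n (A : 'M[R]_(m, n)) (b : 'cV[R]_m)
    (xs : 'cV[R]_n) (q : nat) (G : R) (stop : term_cond R m n)
    (x : nat -> 'cV[R]_n) (z : nat -> nat -> 'cV[R]_n)
    (lam : nat -> nat -> 'cV[R]_m) (eps : R) : \bar R :=
  (\sum_(0 <= k <oo | ((k%:R)%:E < Keps xs x eps)%E)
     inner_iters A b q G stop x z lam k)%E.

Definition Erad (R : realType) m n (A : 'M[R]_(m, n)) (xs : 'cV[R]_n) (r : R) : R :=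
  let L := Lconst A in
  1 / (2 * L) *
    (Num.sqrt (L ^+ 2 * norm2 xs ^+ 2 + 4 * r * L) - L * norm2 xs).

Definition Crate (R : realType) (ls gL rho : R) : R :=
  1 - 5 * Num.min (ls * gL) 2 / (16 * (1 + rho)).

Definition Bbound (R : realType) m n (A : 'M[R]_(m, n)) (xs : 'cV[R]_n) (r : R) : R :=
  2 / m%:R * specnorm A * (norm2 xs + r)
    * \big[Num.max/0]_(i < m) norm2 (datavec A i).

(* Main.v *)
(* F differs from its model linearized inside the absolute values by at most
   (L/2)|z|^2, so for t_k <= 1/L the value H_k(z) majorizes F(x^k + z).  Weak
   duality bounds D_k by H_k at points on a segment towards the nearest of xs and
   -xs; by sharpness the best such point lowers F(x^k) - D_k by a fixed fraction of
   F(x^k) - F(xs), and (LAC) passes this decrease on to F(x^{k+1}).  (HAC) with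
   rho implies (LAC) with 2 rho / (1 - 4 rho).  The same decrease, measured
   against t_k, makes the solver's O(1/j^2) gap meet the termination test after a
   number of inner steps that does not depend on k.  Near the solutions
   t_k = G r(x^k) is comparable to Delta(x^k), and the linear rate bounds the
   number of outer iterations by the quotient of logarithms. *)
Require Import Defs.
From HB Require Import structures.
From mathcomp Require Import all_boot all_order all_algebra.
From mathcomp Require Import all_classical all_reals all_analysis.
From mathcomp Require Import ring lra.
Import Order.TTheory GRing.Theory Num.Theory.
Import numFieldNormedType.Exports.
Set Implicit Arguments.
Unset Strict Implicit.
Unset Printing Implicit Defensive.
Local Open Scope ring_scope.

(** * Euclidean and spectral norms *)

Section Vectors.
Context {R : realType}.

Lemma dotvC n (u v : 'cV[R]_n) : dotv u v = dotv v u.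
Proof. by apply: eq_bigr => i _; rewrite mulrC. Qed.

Lemma dotvDl n (u v w : 'cV[R]_n) : dotv (u + v) w = dotv u w + dotv v w.
Proof. by rewrite -big_split; apply: eq_bigr => i _; rewrite mxE mulrDl. Qed.

Lemma dotvDr n (u v w : 'cV[R]_n) : dotv u (v + w) = dotv u v + dotv u w.
Proof. by rewrite dotvC dotvDl !(dotvC u). Qed.

Lemma dotvZl n a (u v : 'cV[R]_n) : dotv (a *: u) v = a * dotv u v.
Proof. by rewrite mulr_sumr; apply: eq_bigr => i _; rewrite mxE mulrA. Qed.

Lemma dotvZr n a (u v : 'cV[R]_n) : dotv u (a *: v) = a * dotv u v.
Proof. by rewrite dotvC dotvZl dotvC. Qed.

Lemma dotvNr n (u v : 'cV[R]_n) : dotv u (- v) = - dotv u v.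
Proof. by rewrite -scaleN1r dotvZr mulN1r. Qed.

Lemma dotvBr n (u v w : 'cV[R]_n) : dotv u (v - w) = dotv u v - dotv u w.
Proof. by rewrite dotvDr dotvNr. Qed.

Lemma dotv0r n (u : 'cV[R]_n) : dotv u 0 = 0.
Proof. by rewrite [LHS]big1// => i _; rewrite mxE mulr0. Qed.

Lemma dotv_trmx m n (M : 'M[R]_(m, n)) (u : 'cV[R]_m) (v : 'cV[R]_n) :
  dotv u (M *m v) = dotv (M^T *m u) v.
Proof.
have dotvE k (a c : 'cV[R]_k) : dotv a c = (a^T *m c) 0 0.
  by rewrite mxE; apply: eq_bigr => i _; rewrite mxE.
by rewrite !dotvE trmx_mul trmxK mulmxA.
Qed.

Lemma norm2_ge0 n (v : 'cV[R]_n) : 0 <= norm2 v.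
Proof. exact: sqrtr_ge0. Qed.

Lemma norm2_sqr n (v : 'cV[R]_n) : norm2 v ^+ 2 = dotv v v.
Proof.
rewrite sqr_sqrtr; last by apply: sumr_ge0 => i _; rewrite sqr_ge0.
by apply: eq_bigr => i _; rewrite expr2.
Qed.

Lemma norm2D_sqr n (u v : 'cV[R]_n) :
  norm2 (u + v) ^+ 2 = norm2 u ^+ 2 + 2 * dotv u v + norm2 v ^+ 2.
Proof. by rewrite !norm2_sqr !dotvDl !dotvDr (dotvC v u); ring. Qed.

Lemma norm2Z n a (v : 'cV[R]_n) : norm2 (a *: v) = `|a| * norm2 v.
Proof.
apply/eqP; rewrite -(@eqrXn2 _ 2) ?mulr_ge0 ?norm2_ge0 //.
by rewrite exprMn !norm2_sqr dotvZl dotvZr mulrA real_normK ?num_real.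
Qed.

Lemma norm2N n (v : 'cV[R]_n) : norm2 (- v) = norm2 v.
Proof. by rewrite -scaleN1r norm2Z normrN1 mul1r. Qed.

Lemma norm2_0 n : norm2 (0 : 'cV[R]_n) = 0.
Proof. by rewrite -(scale0r (0 : 'cV[R]_n)) norm2Z normr0 mul0r. Qed.

Lemma norm2_eq0 n (v : 'cV[R]_n) : norm2 v = 0 -> v = 0.
Proof.
move=> v0; have /eqP := norm2_sqr v; rewrite v0 expr0n eq_sym /=.
rewrite psumr_eq0 => [/allP h|i _]; last by rewrite -expr2 sqr_ge0.
apply/matrixP => i j; rewrite ord1 mxE; apply/eqP.
by have := h i (mem_index_enum _); rewrite -expr2 sqrf_eq0.
Qed.

Lemma Cauchy_Schwarz n (u v : 'cV[R]_n) : dotv u v <= norm2 u * norm2 v.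
Proof.
have := norm2_ge0 u; have := norm2_ge0 v; rewrite !le_eqVlt.
case/orP => [/eqP/esym v0|v0].
  by rewrite v0 (norm2_eq0 v0) dotv0r mulr0 eqxx.
case/orP => [/eqP/esym u0|u0].
  by rewrite u0 (norm2_eq0 u0) dotvC dotv0r mul0r eqxx.
have h : 0 <= norm2 (norm2 v *: u - norm2 u *: v) ^+ 2 by rewrite sqr_ge0.
rewrite norm2D_sqr norm2N dotvNr dotvZl dotvZr !norm2Z in h.
rewrite !ger0_norm ?norm2_ge0// in h.
rewrite -le_eqVlt -(ler_pM2l (mulr_gt0 u0 v0)) -subr_ge0.
by rewrite -(pmulr_rge0 _ (ltr0Sn R 1)); apply: le_trans h _; lra.
Qed.

Lemma Cauchy_Schwarz_norm n (u v : 'cV[R]_n) :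
  `|dotv u v| <= norm2 u * norm2 v.
Proof.
by rewrite ler_norml Cauchy_Schwarz lerNl -dotvNr -(norm2N v) Cauchy_Schwarz.
Qed.

Lemma norm2D n (u v : 'cV[R]_n) : norm2 (u + v) <= norm2 u + norm2 v.
Proof.
rewrite -(@ler_pXn2r _ 2) ?nnegrE ?addr_ge0 ?norm2_ge0//.
by rewrite norm2D_sqr; have := Cauchy_Schwarz u v; lra.
Qed.

Lemma norm1D n (u v : 'cV[R]_n) : norm1 (u + v) <= norm1 u + norm1 v.
Proof.
by rewrite -big_split; apply: ler_sum => i _; rewrite mxE ler_normD.
Qed.

Lemma norm1Z n a (v : 'cV[R]_n) : norm1 (a *: v) = `|a| * norm1 v.
Proof. by rewrite mulr_sumr; apply: eq_bigr => i _; rewrite mxE normrM. Qed.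

Lemma ler_mx_norm m n (M : 'M[R]_(m, n)) i j : `|M i j| <= `|M|.
Proof.
rewrite [leRHS]mx_normrE.
exact: (@le_bigmax _ _ _ 0 (fun ij => `|M ij.1 ij.2|) (i, j)).
Qed.

Lemma dotv_le_norm1 n (u v : 'cV[R]_n) : `|u| <= 1 -> dotv u v <= norm1 v.
Proof.
move=> u1; apply: ler_sum => i _; rewrite (le_trans (ler_norm _))// normrM.
by rewrite ler_piMl// (le_trans _ u1)// ler_mx_norm.
Qed.

Section SpectralNorm.
Context {m n : nat}.
Implicit Types (M : 'M[R]_(m, n)) (v : 'cV[R]_n).

Lemma mulmx_datavec M v i : (M *m v) i 0 = dotv (datavec M i) v.
Proof. by rewrite mxE; apply: eq_bigr => j _; rewrite !mxE. Qed.

Lemma norm2_mulmx_sqr M v :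
  norm2 (M *m v) ^+ 2 = \sum_i dotv (datavec M i) v ^+ 2.
Proof.
by rewrite norm2_sqr; apply: eq_bigr => i _; rewrite mulmx_datavec expr2.
Qed.

(** A finite operator bound: it makes the supremum in [specnorm] a genuine one, not the default
    value of [sup], and links it to the row norms. *)
Definition Frobenius M : R := Num.sqrt (\sum_i norm2 (datavec M i) ^+ 2).

Lemma Frobenius_sqr M : Frobenius M ^+ 2 = \sum_i norm2 (datavec M i) ^+ 2.
Proof. by rewrite sqr_sqrtr//; apply: sumr_ge0 => i _; rewrite sqr_ge0. Qed.

Lemma norm2_mulmx_Frobenius M v : norm2 (M *m v) <= Frobenius M * norm2 v.
Proof.
rewrite -(@ler_pXn2r _ 2) ?nnegrE ?mulr_ge0 ?sqrtr_ge0 ?norm2_ge0//.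
rewrite exprMn Frobenius_sqr norm2_mulmx_sqr mulr_suml; apply: ler_sum => i _.
rewrite -exprMn -real_normK ?num_real//.
by rewrite ler_pXn2r ?nnegrE ?mulr_ge0 ?norm2_ge0// Cauchy_Schwarz_norm.
Qed.

Let unit_image M :=
  [set norm2 (M *m v) | v in [set v : 'cV[R]_n | norm2 v <= 1]]%classic.

Let has_sup_unit_image M : has_sup (unit_image M).
Proof.
split; first by exists (norm2 (M *m 0)), 0; rewrite //= norm2_0.
exists (Frobenius M) => _ [v /= v1 <-].
by rewrite (le_trans (norm2_mulmx_Frobenius _ _))// ler_piMr// sqrtr_ge0.
Qed.

Lemma specnorm_ge0 M : 0 <= specnorm M.
Proof.
apply: (@sup_ubound _ (unit_image M)); first by case: (has_sup_unit_image M).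
by exists 0; rewrite /= ?norm2_0// mulmx0 norm2_0.
Qed.

Lemma norm2_mulmx_specnorm M v : norm2 (M *m v) <= specnorm M * norm2 v.
Proof.
have := norm2_ge0 v; rewrite le_eqVlt => /orP[/eqP/esym v0|v0].
  by rewrite v0 (norm2_eq0 v0) mulmx0 norm2_0 mulr0.
rewrite -ler_pdivrMr// mulrC.
apply: (@sup_ubound _ (unit_image M)); first by case: (has_sup_unit_image M).
exists ((norm2 v)^-1 *: v); rewrite /= ?norm2Z -?scalemxAr ?norm2Z.
  by rewrite ger0_norm ?invr_ge0 ?norm2_ge0// mulVf// gt_eqF.
by rewrite ger0_norm ?invr_ge0 ?norm2_ge0.
Qed.

Lemma specnorm_le M c : 0 <= c ->
  (forall v, norm2 (M *m v) <= c * norm2 v) -> specnorm M <= c.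
Proof.
move=> c0 Mc; apply: ge_sup; first by case: (has_sup_unit_image M).
by move=> _ [v /= v1 <-]; rewrite (le_trans (Mc v))// ler_piMr.
Qed.

(** The spectral norm is at most the Frobenius norm, whose square is a sum of [m] squared row
    norms. *)
Lemma specnorm_sqr_le M :
  specnorm M ^+ 2 <= m%:R * (\big[Num.max/0]_(i < m) norm2 (datavec M i)) ^+ 2.
Proof.
have F0 : 0 <= Frobenius M by exact: sqrtr_ge0.
have : specnorm M ^+ 2 <= Frobenius M ^+ 2.
  rewrite ler_pXn2r ?nnegrE ?specnorm_ge0//.
  exact: specnorm_le F0 (norm2_mulmx_Frobenius M).
move=> /le_trans; apply; rewrite Frobenius_sqr.
set a := (X in _ <= _ * X ^+ 2); rewrite mulr_natl.
rewrite -[m in leRHS]card_ord -sumr_const.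
apply: ler_sum => i _; have ai : norm2 (datavec M i) <= a.
  exact: (le_bigmax (0 : R) (fun i => norm2 (datavec M i))).
by rewrite ler_pXn2r ?nnegrE ?norm2_ge0// (le_trans _ ai)// norm2_ge0.
Qed.

End SpectralNorm.
End Vectors.

(** * Distance to the pair [xs], [- xs] *)

Section Distance.
Context {R : realType} {n : nat}.
Implicit Types x xs z : 'cV[R]_n.

Lemma Delta_ge0 xs x : 0 <= Delta xs x.
Proof. by rewrite le_min !norm2_ge0. Qed.

Lemma norm2B xs x : norm2 (x - xs) = norm2 (xs - x).
Proof. by rewrite -norm2N opprB. Qed.

Lemma Delta_nearest xs x :
  exists2 y, y = xs \/ y = - xs & norm2 (y - x) = Delta xs x.
Proof.
rewrite /Delta; case: (leP (norm2 (x - xs)) (norm2 (x + xs))) => _.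
  by exists xs; [left|rewrite norm2B].
by exists (- xs); [right|rewrite norm2B opprK].
Qed.

Lemma Delta_add xs x z : Delta xs x - norm2 z <= Delta xs (x + z).
Proof.
have tri y : norm2 (x + y) <= norm2 (x + z + y) + norm2 z.
  rewrite -(norm2N z) (le_trans _ (norm2D _ _))//.
  by rewrite [x + z + y]addrAC addrK.
by rewrite lerBlDr addr_minl le_min !ge_min !tri orbT.
Qed.

Lemma norm2_le_Delta xs x : norm2 x <= norm2 xs + Delta xs x.
Proof.
have [y [] -> <-] := Delta_nearest xs x; rewrite norm2B.
  by rewrite -{1}(subrK xs x) addrC (le_trans (norm2D _ _)).
by rewrite opprK -{1}(addrK xs x) addrC -(norm2N xs) (le_trans (norm2D _ _)).
Qed.

(** One factor is [Delta xs x]; the other exceeds it by at most [2 * norm2 xs], the distance between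
    [xs] and [- xs]. *)
Lemma norm2_prod_le_Delta xs x :
  norm2 (x - xs) * norm2 (x + xs) <= Delta xs x * (Delta xs x + 2 * norm2 xs).
Proof.
have tri (y w : 'cV[R]_n) : norm2 w <= norm2 y + norm2 (w - y).
  by rewrite -{1}(subrK y w) addrC norm2D.
have two : norm2 (xs + xs) = 2 * norm2 xs.
  by rewrite -mulr2n -scaler_nat norm2Z ger0_norm.
rewrite /Delta; case: (leP (norm2 (x - xs)) (norm2 (x + xs))) => _.
  rewrite ler_wpM2l ?norm2_ge0// (le_trans (tri (x - xs) _))//.
  by rewrite opprB [x + xs + _]addrC addrA subrK two.
rewrite mulrC ler_wpM2l ?norm2_ge0// (le_trans (tri (x + xs) _))//.
by rewrite [x - xs]addrC opprD [_ + (- x - xs)]addrA addrK -opprD norm2N two.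
Qed.

End Distance.

(** * The linearized model and its dual *)

Section Model.
Context {R : realType} {m n : nat}.
Variables (A : 'M[R]_(m, n)) (b : 'cV[R]_m).
Implicit Types x y z : 'cV[R]_n.
Let L := Lconst A.

(* F linearized inside the absolute values at x, evaluated at x + z. *)
Definition Flin x z : R := norm1 (Bmat A x *m z - dvec A b x).

Lemma Lconst_ge0 : 0 <= L.
Proof. by rewrite divr_ge0// mulr_ge0// sqr_ge0. Qed.

Lemma FlinE x z :
  Flin x z = m%:R^-1 * \sum_i `|dotv (datavec A i) x ^+ 2
                + 2 * dotv (datavec A i) x * dotv (datavec A i) z - b i 0|.
Proof.
rewrite mulr_sumr; apply: eq_bigr => i _.
rewrite -[in RHS](@ger0_norm _ m%:R^-1) ?invr_ge0// -normrM; congr `|_|.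
rewrite -(mulmx_datavec A x) -(mulmx_datavec A z).
rewrite /Bmat /dvec -scalemxAl -mulmxA mul_diag_mx; set u := A *m x.
set v := A *m z; rewrite !mxE real_normK ?num_real//; ring.
Qed.

Lemma mean_dotv_sqr_le z :
  m%:R^-1 * \sum_i dotv (datavec A i) z ^+ 2 <= L / 2 * norm2 z ^+ 2.
Proof.
have -> : L / 2 * norm2 z ^+ 2 = m%:R^-1 * (specnorm A * norm2 z) ^+ 2.
  by rewrite /L /Lconst; lra.
rewrite ler_wpM2l ?invr_ge0// -norm2_mulmx_sqr.
by rewrite ler_pXn2r ?nnegrE ?mulr_ge0 ?norm2_ge0 ?specnorm_ge0//
   norm2_mulmx_specnorm.
Qed.

(** Inside each absolute value the exact and linearized terms differ by [dotv (datavec A i) z ^+ 2];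
    the mean of these gives the quadratic term. *)
Lemma Fobj_le_Flin x z : Fobj A b (x + z) <= Flin x z + L / 2 * norm2 z ^+ 2.
Proof.
apply: le_trans (lerD (lexx _) (mean_dotv_sqr_le z)).
rewrite FlinE -mulrDr ler_wpM2l ?invr_ge0// -big_split ler_sum//= => i _.
rewrite /resid dotvDr -(ger0_norm (sqr_ge0 (dotv (datavec A i) z))).
by rewrite (le_trans _ (ler_normD _ _))// le_eqVlt; apply/orP; left;
   apply/eqP; congr `|_|; ring.
Qed.

Lemma Flin_le_Fobj x z : Flin x z <= Fobj A b (x + z) + L / 2 * norm2 z ^+ 2.
Proof.
apply: le_trans (lerD (lexx _) (mean_dotv_sqr_le z)).
rewrite FlinE -mulrDr ler_wpM2l ?invr_ge0// -big_split ler_sum//= => i _.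
rewrite /resid dotvDr -(ger0_norm (sqr_ge0 (dotv (datavec A i) z)))
  -(normrN (dotv (datavec A i) z ^+ 2)).
by rewrite (le_trans _ (ler_normD _ _))// le_eqVlt; apply/orP; left;
   apply/eqP; congr `|_|; ring.
Qed.

Lemma Flin0 x : Flin x 0 = Fobj A b x.
Proof.
rewrite FlinE; congr (_ * _); apply: eq_bigr => i _; congr `|_|.
by rewrite dotv0r mulr0 addr0.
Qed.

Lemma Flin_convex x y z (s : R) : 0 <= s <= 1 ->
  Flin x ((1 - s) *: y + s *: z) <= (1 - s) * Flin x y + s * Flin x z.
Proof.
move=> /andP[s0 s1]; rewrite /Flin.
have t0 : 0 <= 1 - s by rewrite subr_ge0.
rewrite -[X in X * _ + _](ger0_norm t0) -[X in _ + X * _](ger0_norm s0).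
rewrite -!norm1Z.
apply: le_trans (norm1D _ _); rewrite le_eqVlt; apply/orP; left; apply/eqP.
congr norm1; rewrite mulmxDr -!scalemxAr !scalerBr addrACA -opprD -scalerDl.
by rewrite subrK scale1r.
Qed.

Lemma FobjN x : Fobj A b (- x) = Fobj A b x.
Proof.
congr (_ * _); apply: eq_bigr => i _.
by rewrite /resid dotvNr sqrrN.
Qed.

(** Each difference of squares factors as <a, x - xs> <a, x + xs>; Cauchy-Schwarz on the entrywise
    absolute values then separates the two factors. *)
Lemma Fobj_upper x xs : Fobj A b x - Fobj A b xs <=
  L / 2 * (norm2 (x - xs) * norm2 (x + xs)).
Proof.
pose absA y := \col_i `|(A *m y) i 0|.
have absAE y i : absA y i 0 = `|dotv (datavec A i) y|.
  by rewrite mxE mulmx_datavec.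
have norm_absA y : norm2 (absA y) = norm2 (A *m y).
  congr Num.sqrt; apply: eq_bigr => i _.
  by rewrite absAE mulmx_datavec real_normK ?num_real.
rewrite /Fobj -mulrBr -sumrB.
have -> : L / 2 * (norm2 (x - xs) * norm2 (x + xs)) =
  m%:R^-1 * ((specnorm A * norm2 (x - xs)) * (specnorm A * norm2 (x + xs))).
  by rewrite /L /Lconst; lra.
rewrite ler_wpM2l ?invr_ge0//.
apply: (@le_trans _ _ (dotv (absA (x - xs)) (absA (x + xs)))).
  apply: ler_sum => i _; rewrite /resid lerBlDr !absAE -normrM.
  apply: le_trans (ler_normD _ _); rewrite le_eqVlt; apply/orP; left; apply/eqP.
  by congr `|_|; rewrite !dotvDr dotvNr; ring.
rewrite (le_trans (Cauchy_Schwarz _ _))// !norm_absA.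
by rewrite ler_pM ?norm2_ge0// norm2_mulmx_specnorm.
Qed.

Lemma Fobj_upper_Delta x xs : Fobj A b x - Fobj A b xs <=
  L / 2 * (Delta xs x * (Delta xs x + 2 * norm2 xs)).
Proof.
rewrite (le_trans (Fobj_upper _ _))// ler_wpM2l ?norm2_prod_le_Delta//.
by rewrite divr_ge0// Lconst_ge0.
Qed.

Lemma Fobj_nearest x xs :
  exists2 w, norm2 w = Delta xs x & Fobj A b (x + w) = Fobj A b xs.
Proof.
have [y yxs <-] := Delta_nearest xs x; exists (y - x) => //.
by rewrite addrC subrK; case: yxs => ->; rewrite ?FobjN.
Qed.

Lemma HprimalE x t z :
  Hprimal A b x t z = (2 * t)^-1 * norm2 z ^+ 2 + Flin x z.
Proof. by rewrite /Hprimal mul1r. Qed.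

Lemma Hprimal0 x t : Hprimal A b x t 0 = Fobj A b x.
Proof. by rewrite HprimalE norm2_0 expr0n/= mulr0 add0r Flin0. Qed.

(** The sup-norm bound on [lam] gives lam^T (B z - d) <= ||B z - d||_1; what remains is the square
    |z + t B^T lam|^2 / (2t). *)
Lemma weak_duality x t z lam : 0 < t -> `|lam| <= 1 ->
  Ddual A b x t lam <= Hprimal A b x t z.
Proof.
move=> t0 lam1; rewrite HprimalE /Ddual.
have := dotv_le_norm1 (Bmat A x *m z - dvec A b x) lam1.
rewrite dotvBr dotv_trmx -/(Flin x z); set u := _ *m lam => le1.
have : 0 <= (2 * t)^-1 * norm2 (z + t *: u) ^+ 2.
  by rewrite mulr_ge0 ?sqr_ge0// invr_ge0 mulr_ge0// ltW.
rewrite norm2D_sqr dotvZr norm2Z exprMn real_normK ?num_real// (dotvC z).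
have -> : (2 * t)^-1 *
   (norm2 z ^+ 2 + 2 * (t * dotv u z) + t ^+ 2 * norm2 u ^+ 2) =
   (2 * t)^-1 * norm2 z ^+ 2 + dotv u z + t / 2 * norm2 u ^+ 2.
  by field; rewrite gt_eqF.
lra.
Qed.

(** The diagonal factor scales entry i by [dotv (datavec A i) x], at most [norm2 x] times the
    largest row norm. *)
Lemma specnorm_Bmat x xs r : norm2 x <= norm2 xs + r ->
  specnorm (Bmat A x) <= Bbound A xs r.
Proof.
move=> xr; have c0 : 0 <= 2 / m%:R :> R by rewrite divr_ge0.
rewrite /Bbound; set amax := bigop _ _ _.
have amax_ge i : norm2 (datavec A i) <= amax.
  exact: (le_bigmax (0 : R) (fun i => norm2 (datavec A i))).
have amax0 : 0 <= amax by exact: bigmax_ge_id.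
have r0 : 0 <= norm2 xs + r by rewrite (le_trans (norm2_ge0 x)).
apply: specnorm_le => [|v]; first by rewrite !mulr_ge0 ?specnorm_ge0.
rewrite /Bmat -scalemxAl norm2Z ger0_norm//.
rewrite [leRHS](_ : _ = 2 / m%:R *
  ((norm2 xs + r) * amax * (specnorm A * norm2 v))); last by ring.
rewrite ler_wpM2l//.
apply: (@le_trans _ _ ((norm2 xs + r) * amax * norm2 (A *m v))); last first.
  by rewrite ler_wpM2l ?mulr_ge0// norm2_mulmx_specnorm.
rewrite -mulmxA -(@ler_pXn2r _ 2) ?nnegrE ?mulr_ge0 ?norm2_ge0//.
rewrite exprMn !norm2_sqr mulr_sumr mul_diag_mx; apply: ler_sum => i _.
rewrite -!expr2; rewrite mxE [_^T _ _]mxE exprMn ler_wpM2r ?sqr_ge0//.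
rewrite mulmx_datavec.
rewrite -real_normK ?num_real// ler_pXn2r ?nnegrE ?mulr_ge0//.
rewrite (le_trans (Cauchy_Schwarz_norm _ _))// mulrC.
by rewrite ler_pM ?norm2_ge0.
Qed.

End Model.

(** * One outer iteration *)

Section Subproblem.
Context {R : realType} {m n : nat}.
Variables (A : 'M[R]_(m, n)) (b : 'cV[R]_m) (xs : 'cV[R]_n) (ls : R).
Hypothesis hls : 0 < ls.
Hypothesis hsharp : forall x : 'cV[R]_n,
  ls * Delta xs x <= Fobj A b x - Fobj A b xs.
Variables (x : 'cV[R]_n) (t : R) (lam : 'cV[R]_m).
Hypotheses (t0 : 0 < t) (lam1 : `|lam| <= 1).
Implicit Types (z : 'cV[R]_n) (rho s W : R).
Let L := Lconst A.
Let D := Delta xs x.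
Let dF := Fobj A b x - Fobj A b xs.
Let gap z := Hprimal A b x t z - Ddual A b x t lam.
Hypotheses (D0 : 0 < D) (LD : L * D <= ls / 4).

(** Weak duality at [(1 - s) *: z + s *: w], where [x + w] is the nearer of [xs] and [- xs], with
    convexity of the model along the segment. *)
Lemma Ddual_le_segment z s : 0 <= s <= 1 ->
  Ddual A b x t lam <= (2 * t)^-1 * ((1 - s) * norm2 z + s * D) ^+ 2
    + (1 - s) * Flin A b x z + s * (Fobj A b xs + L / 2 * D ^+ 2).
Proof.
move=> s01; have /andP[s0 s1] := s01.
have [w wD Fw] := Fobj_nearest A b x xs.
have /(_ ((1 - s) *: z + s *: w)) := weak_duality A b x _ t0 lam1.
move=> /le_trans; apply; rewrite HprimalE -addrA lerD//.
  rewrite ler_wpM2l ?invr_ge0 ?mulr_ge0 ?(ltW t0)//.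
  have v0 : 0 <= 1 - s by rewrite subr_ge0.
  rewrite ler_pXn2r ?nnegrE ?addr_ge0 ?mulr_ge0 ?norm2_ge0 ?(ltW D0)//.
  by rewrite (le_trans (norm2D _ _))// !norm2Z !ger0_norm// wD -/D.
rewrite (le_trans (Flin_convex _ _ _ _ _ s01))// lerD2l ler_wpM2l//.
by rewrite -Fw /D -wD Flin_le_Fobj.
Qed.

(** The segment bound from 0. Since [L * D <= ls / 4], sharpness bounds the curvature term
    [L / 2 * D ^+ 2] by [dF / 8]. *)
Lemma dual_decrease s : 0 <= s <= 1 ->
  7 / 8 * s * dF - (2 * t)^-1 * (s * D) ^+ 2
    <= Fobj A b x - Ddual A b x t lam.
Proof.
move=> s01; have /andP[s0 s1] := s01.
have := Ddual_le_segment 0 s01; rewrite Flin0 norm2_0 mulr0 add0r => h.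
have LD2 : L / 2 * D ^+ 2 <= dF / 8.
  have := hsharp x; rewrite -/D -/dF => sh.
  have := ler_wpM2r (ltW D0) LD; lra.
have := ler_wpM2l s0 LD2; rewrite /dF; lra.
Qed.

(** Take [s * D = Num.min (ls * t / 2) D]. A length of at most [ls * t / 2] keeps the quadratic cost
    within a quarter of [ls * (s * D)], and 7/8 - 1/4 = 5/8. *)
Lemma dual_decrease_stepsize :
  5 / 8 * ls * Num.min (ls * t / 2) D <= Fobj A b x - Ddual A b x t lam.
Proof.
have sh : ls * D <= dF := hsharp x.
have tV : (2 * t)^-1 * t = 1 / 2.
  by field; rewrite gt_eqF.
case: (leP (ls * t / 2) D) => h.
  pose s := ls * t / 2 / D.
  have sD : s * D = ls * t / 2 by rewrite divfK// gt_eqF.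
  have s0 : 0 <= s by rewrite !divr_ge0 ?mulr_ge0 ?ltW.
  have s1 : s <= 1 by rewrite ler_pdivrMr// mul1r.
  have s01 : 0 <= s <= 1 by rewrite s0.
  have := dual_decrease s01; apply: le_trans.
  have := ler_wpM2l s0 sh.
  have -> : s * (ls * D) = ls * (ls * t / 2) by rewrite -sD; ring.
  rewrite sD.
  have -> : (2 * t)^-1 * (ls * t / 2) ^+ 2 = ls * ls * t / 8.
    by field; rewrite gt_eqF.
  lra.
have s01 : 0 <= (1 : R) <= 1 by rewrite ler01 lexx.
have := dual_decrease s01; apply: le_trans; rewrite mul1r mulr1.
have : (2 * t)^-1 * D ^+ 2 <= ls * D / 4.
  rewrite mulrC ler_pdivrMr ?mulr_gt0//.
  have := ler_wpM2l (ltW D0) (ltW h); lra.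
lra.
Qed.

(** Take [s = Num.min (ls * g / 2) 1]. Sharpness and [g * D <= t] bound the quadratic cost by
    [s * dF / 4], leaving [5 / 8 * s * dF]. *)
Lemma dual_decrease_rate g : 0 < g -> g * D <= t ->
  5 / 16 * Num.min (ls * g) 2 * dF <= Fobj A b x - Ddual A b x t lam.
Proof.
move=> g0 gt; have sh : ls * D <= dF := hsharp x.
have mu0 : 0 < ls * g by rewrite mulr_gt0.
have dF0 : 0 <= dF by rewrite (le_trans _ sh)// mulr_ge0 ?ltW.
have quad : ls * g * ((2 * t)^-1 * D ^+ 2) <= dF / 2.
  have -> : ls * g * ((2 * t)^-1 * D ^+ 2) =
      (ls * D * (g * D)) / (2 * t).
    by field; rewrite gt_eqF.
  rewrite ler_pdivrMr ?mulr_gt0//.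
  have -> : dF / 2 * (2 * t) = dF * t by field.
  by rewrite ler_pM// mulr_ge0// ltW.
case: (leP (ls * g) 2) => h.
  have s01 : 0 <= ls * g / 2 <= 1 by rewrite divr_ge0 ?(ltW mu0)//=; lra.
  have := dual_decrease s01; apply: le_trans.
  have := ler_wpM2l (ltW mu0) quad; rewrite exprMn.
  set X := _^-1 * _ => h2.
  have -> : (2 * t)^-1 * ((ls * g / 2) ^+ 2 * D ^+ 2) =
     ls * g * (ls * g * ((2 * t)^-1 * D ^+ 2)) / 4.
    by field; rewrite gt_eqF.
  rewrite -/X; lra.
have s01 : 0 <= (1 : R) <= 1 by rewrite ler01 lexx.
have := dual_decrease s01; apply: le_trans; rewrite mul1r mulr1.
have X0 : 0 <= (2 * t)^-1 * D ^+ 2.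
  by rewrite mulr_ge0 ?sqr_ge0 ?invr_ge0 ?mulr_ge0 ?(ltW t0).
have := ler_wpM2r X0 (ltW h); lra.
Qed.

(** For [t * L <= 1] the primal value majorizes [Fobj]. (LAC) rearranges to F(x) - Ddual <= (1 +
    rho) (F(x) - H(z)), so a share 1 / (1 + rho) of the dual decrease survives. *)
Lemma LAC_contraction g rho z : 0 < rho -> 0 < g -> g * D <= t -> t * L <= 1 ->
  LAC A b rho x t z lam ->
  Fobj A b (x + z) - Fobj A b xs <= Crate ls g rho * dF.
Proof.
move=> rho0 g0 gt tL; rewrite /LAC Hprimal0 => lac.
have FH : Fobj A b (x + z) <= Hprimal A b x t z.
  rewrite (le_trans (Fobj_le_Flin _ _ _ _))// HprimalE addrC lerD2r.
  rewrite ler_wpM2r ?sqr_ge0// -[leRHS]mul1r ler_pdivlMr ?mulr_gt0//.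
  by rewrite -/L; lra.
have := dual_decrease_rate g0 gt; rewrite /Crate.
set H := Hprimal _ _ _ _ _ in lac FH *; set mn := Num.min _ _ => dec.
have r0 : 0 < 16 * (1 + rho) by rewrite mulr_gt0// addr_gt0.
have hyp : 5 * mn * dF <= 16 * (1 + rho) * (Fobj A b x - H) by lra.
have : 5 * mn / (16 * (1 + rho)) * dF <= Fobj A b x - H.
  by rewrite mulrAC ler_pdivrMr// [leRHS]mulrC.
by rewrite mulrBl mul1r /dF; lra.
Qed.

(* Strong convexity of H_k at the midpoint z / 2, combined with weak duality
   there, controls |z|^2, so that no minimizer of H_k is needed. *)
Lemma LAC_of_HAC rho z : 0 < rho -> rho < 1 / 4 ->
  HAC A b rho x t z lam -> LAC A b (2 * rho / (1 - 4 * rho)) x t z lam.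
Proof.
move=> rho0 rho4; rewrite /HAC /LAC Hprimal0 !HprimalE.
have h01 : 0 <= (1 / 2 : R) <= 1 by lra.
have := Flin_convex A b x 0 z h01; rewrite scaler0 add0r Flin0.
have := weak_duality A b x ((1 / 2) *: z) t0 lam1.
rewrite HprimalE norm2Z ger0_norm; last by lra.
set d := Ddual _ _ _ _ _; set f2 := Flin _ _ _ (_ *: z); set f := Flin _ _ _ z.
have -> : rho / (2 * t) * norm2 z ^+ 2 = rho * ((2 * t)^-1 * norm2 z ^+ 2).
  by rewrite -mulrA.
rewrite exprMn; set N := norm2 z ^+ 2 => h1 h2.
have N1 : (2 * t)^-1 * ((1 / 2) ^+ 2 * N) = (2 * t)^-1 * N / 4.
  by field; rewrite gt_eqF.
move: h1; rewrite N1; set Y := _^-1 * N => h1 h3.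
have r4 : 0 < 1 - 4 * rho by lra.
rewrite mulrAC ler_pdivlMr//.
(* Four times the midpoint inequality, with [Y] = |z|^2 / (2t). As the gap is at most [rho * Y],
   solving for the gap yields 2 rho / (1 - 4 rho). *)
have hY : Y <= 4 * (Y + f - d) + 2 * (Fobj A b x - (Y + f)) by lra.
have := ler_wpM2l (ltW rho0) hY; lra.
Qed.

(** (LAC) says that [1 + rho] times the gap is at most [rho] times F(x) - Ddual. The bounds on [W]
    give [t / W <= Num.min (ls * t / 2) D], so this decrease is at least [5 / 8 * ls * (t / W)]. *)
Lemma LAC_of_gap rho W z : 0 < rho -> 2 / ls <= W -> t <= W * D ->
  gap z * (1 + rho) * W <= 5 / 8 * ls * rho * t -> LAC A b rho x t z lam.
Proof.
move=> rho0 lW tW gapz; rewrite /LAC Hprimal0.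
have W0 : 0 < W by rewrite (lt_le_trans _ lW)// divr_gt0.
have tWmin : t / W <= Num.min (ls * t / 2) D.
  rewrite le_min !ler_pdivrMr// [D * W]mulrC tW andbT.
  move: lW; rewrite ler_pdivrMr// => lW.
  have := ler_wpM2l (ltW t0) lW; lra.
have c0 : 0 <= 5 / 8 * ls * rho by rewrite !mulr_ge0 ?ltW//; lra.
have gap1 : gap z * (1 + rho) <= 5 / 8 * ls * rho * (t / W).
  by rewrite mulrA ler_pdivlMr.
have := ler_wpM2l c0 tWmin; have := ler_wpM2l (ltW rho0) dual_decrease_stepsize.
by rewrite /gap in gap1 *; lra.
Qed.

(* If (HAC) failed, z would be so short that moving from it towards the nearest
   of xs and - xs decreases H_k by more than the duality gap allows. *)
Lemma HAC_of_gap rho W z : 0 < rho -> rho < 1 / 4 -> t * L <= 1 ->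
  2 / ls <= W -> t <= W * D ->
  gap z * (16 * (1 + rho) * W ^+ 2) <= rho * t -> HAC A b rho x t z lam.
Proof.
move=> rho0 rho4 tL lW tW gapz; rewrite /HAC leNgt; apply/negP => hac.
have W0 : 0 < W by rewrite (lt_le_trans _ lW)// divr_gt0.
have lW2 : 2 <= ls * W by rewrite mulrC -ler_pdivrMr.
set nu := norm2 z; have nu0 : 0 <= nu by exact: norm2_ge0.
have W20 : 0 < W ^+ 2 by rewrite exprn_gt0.
(* Failure of (HAC) gives [rho * nu ^+ 2 < 2 * t * gap z]; with the assumed gap bound, [nu] is small
   against [t / W], hence against [D] and [ls * t]. *)
have nut : 8 * (nu * W) ^+ 2 <= t ^+ 2.
  have h1 : rho * nu ^+ 2 < 2 * t * gap z.
    move: hac; rewrite -/(gap z) mulrAC ltr_pdivrMr ?mulr_gt0//.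
    by rewrite [X in _ < X]mulrC.
  have h2 : 16 * (1 + rho) * W ^+ 2 * (rho * nu ^+ 2) <= 2 * t * (rho * t).
    apply: (@le_trans _ _ (16 * (1 + rho) * W ^+ 2 * (2 * t * gap z))).
      by rewrite ler_wpM2l ?(ltW h1)// !mulr_ge0 ?ltW//; lra.
    have -> : 16 * (1 + rho) * W ^+ 2 * (2 * t * gap z) =
       2 * t * (gap z * (16 * (1 + rho) * W ^+ 2)) by ring.
    by rewrite ler_wpM2l// mulr_ge0// ltW.
  have h3 : 16 * (1 + rho) * (nu * W) ^+ 2 <= 2 * t ^+ 2.
    rewrite -(ler_pM2l rho0); move: h2; rewrite exprMn; lra.
  have := sqr_ge0 (nu * W); have : 0 <= rho * (nu * W) ^+ 2.
    by rewrite mulr_ge0 ?sqr_ge0// ltW.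
  lra.
have nuW : nu * W <= 3 / 8 * t.
  rewrite -(@ler_pXn2r _ 2) ?nnegrE ?mulr_ge0 ?(ltW W0) ?(ltW t0)//.
  by rewrite exprMn; have := sqr_ge0 t; lra.
have nuD : nu <= 3 / 8 * D by rewrite -(ler_pM2r W0); lra.
have nu_le_D : nu <= D by move: D0; lra.
have nul : nu <= 3 / 16 * ls * t.
  have : nu * 2 <= nu * (ls * W) by rewrite ler_wpM2l.
  have := ler_wpM2l (ltW hls) nuW; lra.
have gz0 : 0 <= gap z by rewrite subr_ge0; exact: weak_duality.
have gapt : 64 * (gap z * W ^+ 2) <= t.
  have e0 := mulr_ge0 gz0 (ltW W20); have := mulr_ge0 e0 (ltW rho0).
  have : rho * t <= 1 / 4 * t by rewrite ler_wpM2r// ltW.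
  by move: gapz; lra.
have tD : t <= 2 * (D * W) by move: t0; lra.
have tl : t <= 2 * (ls * t / 4 * W) by have := ler_wpM2l (ltW t0) lW2; lra.
(* The segment parameter satisfies [s * D = y]. The cap [ls * t / 4] limits the quadratic cost,
   while [t <= 2 * (y * W)] still holds. *)
pose y := Num.min D (ls * t / 4); pose s := y / D.
have y0 : 0 < y by rewrite lt_min D0 divr_gt0// mulr_gt0.
have sD : s * D = y by rewrite divfK// gt_eqF.
have s0 : 0 <= s by rewrite divr_ge0 ?ltW.
have s1 : s <= 1 by rewrite ler_pdivrMr// mul1r ge_min lexx.
have s01 : 0 <= s <= 1 by rewrite s0.
have y4 : y <= ls * t / 4 by rewrite ge_min lexx orbT.
have yW : t <= 2 * (y * W).
  by rewrite /y; case: (leP D (ls * t / 4)).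
have snu : s * nu <= 3 / 8 * y by have := ler_wpM2l s0 nuD; lra.
(* Sharpness at [x + z], where [Delta xs (x + z) >= D - nu]; the two curvature errors cost at most
   [ls / 8] times [nu] and [D]. *)
have model : ls * (7 / 8 * D - 9 / 8 * nu)
    <= Flin A b x z - (Fobj A b xs + L / 2 * D ^+ 2).
  have := Fobj_le_Flin A b x z; have := hsharp (x + z).
  have := ler_wpM2l (ltW hls) (Delta_add xs x z).
  have : nu * (L * D) <= nu * (ls / 4) by rewrite ler_wpM2l.
  have : L * nu * nu <= L * nu * D.
    by rewrite ler_wpM2l// mulr_ge0//; exact: Lconst_ge0.
  have := ler_wpM2l (ltW D0) LD; rewrite -/nu -/D -/L; lra.
have quad : (2 * t)^-1 * ((1 - s) * nu + s * D) ^+ 2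
    <= (2 * t)^-1 * nu ^+ 2 + 5 / 16 * (ls * y).
  pose p := s * (D - nu).
  have p0 : 0 <= p by rewrite mulr_ge0//; lra.
  have py : p <= y by rewrite -sD ler_wpM2l//; lra.
  have pnu : p * (2 * nu + p) <= y * (5 / 8 * ls * t).
    have h : 2 * nu + p <= 5 / 8 * ls * t by lra.
    by apply: ler_pM => //; lra.
  have -> : (2 * t)^-1 * ((1 - s) * nu + s * D) ^+ 2 =
      (2 * t)^-1 * nu ^+ 2 + p * (2 * nu + p) / (2 * t).
    by rewrite /p; field; rewrite gt_eqF.
  by rewrite lerD2l ler_pdivrMr ?mulr_gt0//; lra.
(* The constant is 7/8 - (9/8)(3/8) - 5/16. Since [t <= ls * y * W ^+ 2], the gap times [W ^+ 2] is
   at least 9/64 of [t], against 1/64 in [gapt]. *)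
have gap_ge : 9 / 64 * (ls * y) <= gap z.
  have := Ddual_le_segment z s01; rewrite -/nu /gap HprimalE -/nu.
  have := ler_wpM2l s0 model; have := ler_wpM2l (ltW hls) snu.
  have : s * (ls * D) = ls * y by rewrite -sD; ring.
  lra.
have := ler_wpM2r (ltW W20) gap_ge.
have : t * 2 <= 2 * (y * W) * (ls * W) by apply: ler_pM => //; exact: ltW.
by move: t0; rewrite expr2; lra.
Qed.

End Subproblem.
(** * Iteration counts *)

Section Counting.
Context {R : realType}.

Lemma first_index_min (P : nat -> Prop) j : (1 <= j)%N -> P j ->
  exists j0, [/\ (1 <= j0)%N, P j0, first_index R P = (j0%:R)%:E
    & forall i, (1 <= i)%N -> P i -> (j0 <= i)%N].
Proof.
move=> j1 Pj; have exP : exists i, (1 <= i)%N && `[< P i >].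
  by exists j; rewrite j1; apply/asboolP.
case: (ex_minnP exP) => j0 /andP[j01 /asboolP Pj0] minj0.
have minP i : (1 <= i)%N -> P i -> (j0 <= i)%N.
  by move=> i1 Pi; apply: minj0; rewrite i1; apply/asboolP.
exists j0; split => //; apply/eqP; rewrite eq_le; apply/andP; split.
  by apply: ereal_inf_lbound; exists j0.
by apply: le_ereal_inf_tmp => _ [i [i1 Pi] <-]; rewrite lee_fin ler_nat minP.
Qed.

(** If the least index [j0] exceeds 1, its predecessor fails the test and [j0 < Q]; [j0 = 1] is
    covered by [1 <= Q]. The shift [j.+1] makes the bound [Q] and not [Q + 1]. *)
Lemma first_index_bound (P : nat -> Prop) (Q : R) : 1 <= Q ->
  (forall j, (1 <= j)%N -> Q <= j.+1%:R -> P j) ->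
  exists j0, [/\ (1 <= j0)%N, P j0, first_index R P = (j0%:R)%:E & j0%:R <= Q].
Proof.
move=> Q1 QP; have Pj : P (Num.bound Q).+1.
  apply: QP => //; apply/ltW/(lt_le_trans (archi_boundP _)).
    by rewrite (le_trans ler01).
  by rewrite ler_nat ltnW// ltnW.
have [//|j0 [j01 Pj0 fj0 minj0]] := first_index_min _ Pj.
exists j0; split=> //; case: j0 => [//|[//|j0]] in j01 Pj0 fj0 minj0 *.
rewrite leNgt; apply/negP => /ltW /QP Pj0'.
by have := minj0 j0.+1 isT (Pj0' isT); rewrite ltnn.
Qed.

Lemma lt_first_index (P : nat -> Prop) (k j : nat) :
  ((k%:R : R)%:E < first_index R P)%E -> (1 <= j <= k)%N -> ~ P j.
Proof.
move=> kP /andP[j1 jk] Pj; move: kP; apply/negP; rewrite -leNgt.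
apply: (@le_trans _ _ (j%:R)%:E); last by rewrite lee_fin ler_nat.
by apply: ereal_inf_lbound; exists j.
Qed.

Lemma first_index_gt0 (P : nat -> Prop) : ((0%:R : R)%:E < first_index R P)%E.
Proof.
apply: (@lt_le_trans _ _ 1%:E); first by rewrite lte_fin ltr01.
by apply: le_ereal_inf_tmp => _ [i [i1 _] <-]; rewrite lee_fin ler1n.
Qed.

(** At most [T] indices satisfy [P]. The induction bounds the partial sum up to [N] by
    [Q * Num.min N%:R T]. *)
Lemma nneseries_le_count (P : pred nat) (f : nat -> \bar R) (Q T : R) :
  0 <= Q -> 0 <= T -> (forall k, P k -> (0 <= f k <= Q%:E)%E) ->
  (forall k, P k -> k.+1%:R <= T) ->
  (\sum_(0 <= k <oo | P k) f k <= (Q * T)%:E)%E.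
Proof.
move=> Q0 T0 fQ PT; apply: lime_le.
  by apply: is_cvg_nneseries => k _ /fQ /andP[].
apply: nearW => N.
apply: (@le_trans _ _ (Q * Num.min N%:R T)%:E); last first.
  by rewrite lee_fin ler_wpM2l// ge_min lexx orbT.
elim: N => [|N IH].
  by rewrite big_nil lee_fin mulr_ge0// le_min lexx.
rewrite big_mkcond big_nat_recr//= -big_mkcond; case: ifPn => PN.
  have NT := PT _ PN; rewrite (min_l NT) -natr1 mulrDr mulr1 EFinD leeD//.
    apply: le_trans IH _; rewrite lee_fin ler_wpM2l// ge_min.
    by rewrite lexx.
  by case/andP: (fQ _ PN).
rewrite adde0; apply: le_trans IH _; rewrite lee_fin ler_wpM2l//.
by rewrite le_min !ge_min lexx orbT andbT -natr1 lerDl ler01.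
Qed.

End Counting.

(** * Relations between [ls], [L], [Bbound] and [Erad] *)

Section Constants.
Context {R : realType} {m n : nat}.
Variables (A : 'M[R]_(m, n)) (b : 'cV[R]_m) (xs : 'cV[R]_n) (ls : R).
Hypothesis hls : 0 < ls.
Hypothesis hsharp : forall x : 'cV[R]_n,
  ls * Delta xs x <= Fobj A b x - Fobj A b xs.
Let L := Lconst A.
Let S := norm2 xs.

(* Sharpness along a ray leaving xs, compared with the quadratic upper bound on
   F near xs. *)
Lemma sharpness_ray (u : 'cV[R]_n) : 0 < norm2 u ->
  (forall s : R, 0 < s -> s * norm2 u <= Delta xs (xs + s *: u)) -> ls <= L * S.
Proof.
set d := norm2 u => d0 ray; rewrite leNgt; apply/negP => lt.
have L0 : 0 <= L := Lconst_ge0 A.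
pose e := ls - L * S; have e0 : 0 < e by rewrite subr_gt0.
have den : 0 < L * d + e by rewrite ltr_wpDl// mulr_ge0 ?(ltW d0).
(* Chosen so that [L * (s * d) <= e]: the quadratic term then uses at most half of the margin
   [e]. *)
pose s := e / (L * d + e); have s0 : 0 < s by rewrite divr_gt0.
have sd0 : 0 < s * d by rewrite mulr_gt0.
have Lsd : L * (s * d) <= e.
  have : s * (L * d + e) = e by rewrite divfK// gt_eqF.
  by have := mulr_ge0 (ltW s0) (ltW e0); lra.
have ns : norm2 (s *: u) = s * d by rewrite norm2Z gtr0_norm.
have up := Fobj_upper A b (xs + s *: u) xs.
have := hsharp (xs + s *: u); have := ler_wpM2l (ltW hls) (ray s s0).
move: up; rewrite addrAC subrr add0r ns -/L.
have tri : norm2 (xs + s *: u + xs) <= 2 * S + s * d.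
  rewrite (le_trans (norm2D _ _))// (le_trans (lerD (norm2D _ _) (lexx _)))//.
  by rewrite ns /S; lra.
have h : L / 2 * (s * d * norm2 (xs + s *: u + xs))
    <= L / 2 * (s * d * (2 * S + s * d)).
  apply: ler_wpM2l; first by rewrite divr_ge0.
  by apply: ler_wpM2l => //; exact: ltW.
move=> h1 h2 h3.
have : s * d * ls <= s * d * (L * S + L * (s * d) / 2) by lra.
by rewrite ler_pM2l//; move: e0 Lsd; rewrite /e; lra.
Qed.

(** The ray points along [xs], or along [x] when [xs = 0]; in both cases the distance to [xs]
    realizes [Delta] on it. *)
Lemma sharpness_le x : 0 < Delta xs x -> ls <= L * S.
Proof.
move=> Dx; have := norm2_ge0 xs; rewrite le_eqVlt => /orP[/eqP/esym S0|S0].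
  have xs0 := norm2_eq0 S0.
  apply: (@sharpness_ray x).
    by move: Dx; rewrite /Delta xs0 subr0 addr0 minxx.
  by move=> s s0; rewrite xs0 add0r /Delta subr0 addr0 minxx norm2Z gtr0_norm.
apply: (@sharpness_ray xs) => // s s0.
rewrite /Delta [xs + _ - _]addrAC subrr add0r.
have -> : xs + s *: xs + xs = (2 + s) *: xs.
  by rewrite addrAC -mulr2n -scaler_nat -scalerDl.
rewrite le_min !norm2Z !gtr0_norm ?addr_gt0// lexx/= ler_pM2r//; lra.
Qed.

(** One factor [specnorm A ^+ 2] on the left is at most [m] times the squared largest row norm. This
    later keeps the inner iteration bound at least 1. *)
Lemma Bbound_ge r : 0 <= r -> (L * S) ^+ 2 <= m%:R * Bbound A xs r ^+ 2.
Proof.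
move=> r0; have [m0|m0] := posnP m.
  rewrite /L /Lconst [in X in _ / X]m0 invr0 mulr0 mul0r expr0n.
  by rewrite mulr_ge0// sqr_ge0.
have m0' : 0 < m%:R :> R by rewrite ltr0n.
rewrite /Bbound; have := specnorm_sqr_le A.
set a := bigop _ _ _; set sp := specnorm A => spa.
have S0 : 0 <= S := norm2_ge0 xs.
have -> : m%:R * (2 / m%:R * sp * (norm2 xs + r) * a) ^+ 2 =
    (2 / m%:R) ^+ 2 * sp ^+ 2 * (norm2 xs + r) ^+ 2 * (m%:R * a ^+ 2) by ring.
have -> : (L * S) ^+ 2 = (2 / m%:R) ^+ 2 * sp ^+ 2 * S ^+ 2 * sp ^+ 2.
  by rewrite /L /Lconst -/sp; ring.
apply: ler_pM; rewrite ?sqr_ge0//.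
  by rewrite -!exprMn sqr_ge0.
apply: ler_wpM2l; first by rewrite -exprMn sqr_ge0.
by rewrite ler_pXn2r ?nnegrE ?addr_ge0 ?lerDl// norm2_ge0.
Qed.

(** [Erad A xs r] is the nonnegative root in D of L D (D + S) = r, and the quadratic upper bound L/2
    D (D + 2 S) is no larger than L D (D + S). *)
Lemma Erad_Fobj x r : 0 < L -> 0 <= r -> Delta xs x <= Erad A xs r ->
  Fobj A b x - Fobj A b xs <= r.
Proof.
move=> L0 r0; rewrite /Erad -/L -/S mul1r mulrC ler_pdivlMr; last first.
  exact: mulr_gt0.
have D0 := Delta_ge0 xs x; have S0 : 0 <= S := norm2_ge0 xs.
have arg0 : 0 <= L ^+ 2 * S ^+ 2 + 4 * r * L.
  apply: addr_ge0; first by rewrite -exprMn sqr_ge0.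
  by apply: mulr_ge0 (ltW L0); apply: mulr_ge0.
rewrite lerBrDr -(@ler_pXn2r _ 2) ?nnegrE ?sqrtr_ge0//; last first.
  have L0' := ltW L0.
  by apply: addr_ge0; apply: mulr_ge0 => //; apply: mulr_ge0.
rewrite sqr_sqrtr// => h.
apply: le_trans (Fobj_upper_Delta _ _ _ _) _; rewrite -/L -/S.
set D := Delta xs x in D0 h *.
rewrite -(ler_pM2l L0).
by have := mulr_ge0 (sqr_ge0 L) (sqr_ge0 D); lra.
Qed.

End Constants.

(** * Runs of AdaIPL *)

Section Run.
Context {R : realType} {m n : nat}.
Variables (A : 'M[R]_(m, n)) (b : 'cV[R]_m) (xs : 'cV[R]_n) (ls : R).
Hypothesis hls : 0 < ls.
Hypothesis hsharp : forall x : 'cV[R]_n,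
  ls * Delta xs x <= Fobj A b x - Fobj A b xs.
Variables (q : nat) (uL uH G C0 : R).
Hypotheses (huL : 0 < uL) (huH : 0 < uH) (hG : 0 < G) (hC0 : 2 <= C0).
Hypothesis hr : forall x : 'cV[R]_n,
  uL * (Fobj A b x - Fobj A b xs) <= order_stat q (resid A b x) /\
  order_stat q (resid A b x) <= uH * (Fobj A b x - Fobj A b xs).
Implicit Types (x z : 'cV[R]_n) (lam : 'cV[R]_m).
Local Notation L := (Lconst A).
Local Notation S := (norm2 xs).
Local Notation D := (Delta xs).
Local Notation dF x := (Fobj A b x - Fobj A b xs).
Local Notation t := (stepsize A b q G).
Let gL := G * ls * uL.
Let gH := 3 / 2 * G * L * S * uH.
(** Bounds the numerator of the solver's rate at good iterates, with the factor [t x] removed. *)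
Let c := C0 * m%:R * Bbound A xs (ls / (4 * L)) ^+ 2.

(** Invariant of the outer loop before [Keps]: sharpness dominates curvature at distance [D x], and
    the step size is comparable to that distance. *)
Definition good_iterate x : Prop :=
  [/\ 0 < D x, L * D x <= ls / 4, 0 < t x
    & [/\ gL * D x <= t x, t x <= gH * D x & t x * L <= 1]].

Lemma LS_gt0 x : 0 < D x -> 0 < L /\ 0 < S.
Proof.
move=> D0; have := lt_le_trans hls (sharpness_le hls hsharp D0).
have := Lconst_ge0 A; have := norm2_ge0 xs.
rewrite !le_eqVlt => /orP[/eqP <-|S0]; first by rewrite mulr0 ltxx.
by case/orP => [/eqP <-|//]; rewrite mul0r ltxx.
Qed.

Lemma Delta_le_ls x : 0 < D x -> dF x <= ls ^+ 2 / (4 * L) -> L * D x <= ls / 4.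
Proof.
move=> D0 h; have [L0 S0] := LS_gt0 D0.
have h4 : 0 < 4 * L by apply: mulr_gt0.
move: h; rewrite ler_pdivlMr// => h; have := hsharp x.
rewrite -(ler_pM2r h4) => sh.
rewrite -(ler_pM2l hls); move: sh h; rewrite expr2; lra.
Qed.

(** As [L * D x <= ls / 4 <= L * S / 4], the quadratic term is at most an eighth of
    [L * S * D x]. *)
Lemma Fobj_le_Delta x : 0 < D x -> L * D x <= ls / 4 ->
  dF x <= 3 / 2 * L * S * D x.
Proof.
move=> D0 LD; have lsLS := sharpness_le hls hsharp D0.
apply: le_trans (Fobj_upper_Delta _ _ _ _) _.
have : D x * (L * D x) <= D x * (L * S / 4).
  by rewrite ler_wpM2l ?(ltW D0)//; lra.
have := mulr_ge0 (ltW D0) (le_trans (ltW hls) lsLS); lra.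
Qed.

(** The hypotheses bound [dF], the quantity that contracts along the run. By sharpness the second
    one gives [gH * D x * L <= 1], so the minimum in the step size is [G * r]. *)
Lemma good_iterate_of_gap x : 0 < D x -> dF x <= ls ^+ 2 / (4 * L) ->
  dF x <= ls / (gH * L) -> good_iterate x.
Proof.
move=> D0 h1 h2; have [L0 S0] := LS_gt0 D0; have LD := Delta_le_ls D0 h1.
have gH0 : 0 < gH by do 4!apply: mulr_gt0 => //.
have gL0 : 0 < gL by rewrite /gL !mulr_gt0.
have gHL0 : 0 < gH * L by exact: mulr_gt0.
have [rL rH] := hr x; set r := order_stat _ _ in rL rH.
have lo : gL * D x <= G * r.
  rewrite -[leRHS]mulr1 -!mulrA ler_pM2l// mulr1.
  by apply: le_trans rL; rewrite mulrCA ler_pM2l.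
have hi : G * r <= gH * D x.
  apply: (@le_trans _ _ (G * (uH * (3 / 2 * L * S * D x)))); last first.
    by rewrite /gH; lra.
  rewrite ler_pM2l// (le_trans rH)// ler_pM2l//; exact: Fobj_le_Delta.
have gHD : gH * D x * L <= 1.
  move: h2; rewrite ler_pdivlMr// => h2; rewrite -(ler_pM2l hls) mulr1.
  apply: le_trans h2; have := hsharp x; rewrite -(ler_pM2r gHL0); lra.
have tE : t x = G * r.
  rewrite /stepsize -/r min_r// -[leRHS]mul1r ler_pdivlMr//.
  by rewrite (le_trans _ gHD)// ler_pM2r.
have t0 : 0 < t x by rewrite tE (lt_le_trans _ lo)// mulr_gt0.
by split => //; rewrite tE; split => //; rewrite (le_trans _ gHD)// ler_pM2r.
Qed.

Lemma c_ge x : 0 < D x -> 2 * ls ^+ 2 <= c.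
Proof.
move=> D0; have [L0 S0] := LS_gt0 D0; have lsLS := sharpness_le hls hsharp D0.
rewrite /c -mulrA; apply: ler_pM => //; first by rewrite sqr_ge0.
have r0 : 0 <= ls / (4 * L) by rewrite divr_ge0 ?ltW// mulr_gt0.
apply: le_trans (Bbound_ge A xs r0).
by rewrite ler_pXn2r ?nnegrE// ltW// mulr_gt0.
Qed.

(** The gap at step [j] is at most [t x * c / j.+1%:R ^+ 2]; the factor [t x] cancels, so the
    threshold on [j] is the same at all good iterates. *)
Lemma solver_gap x (z : nat -> 'cV[R]_n) (lam : nat -> 'cV[R]_m) j kappa :
  good_iterate x -> solver_output A b C0 x (t x) z lam -> (1 <= j)%N ->
  0 < kappa -> Num.sqrt (kappa * c) <= j.+1%:R ->
  (Hprimal A b x (t x) (z j) - Ddual A b x (t x) (lam j)) * kappa <= t x.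
Proof.
move=> [D0 LD t0 _] [lam1 gapj] j1 kappa0.
have [L0 S0] := LS_gt0 D0.
have c0 : 0 < c by rewrite (lt_le_trans _ (c_ge D0))// mulr_gt0// exprn_gt0.
have kc0 : 0 <= kappa * c by rewrite mulr_ge0// ltW.
rewrite -(@ler_pXn2r _ 2) ?nnegrE ?sqrtr_ge0// sqr_sqrtr// => kcj.
have gap0 : 0 <= Hprimal A b x (t x) (z j) - Ddual A b x (t x) (lam j).
  by rewrite subr_ge0; exact: weak_duality.
have := gapj j j1; set g := _ - _ in gap0 *.
rewrite ler_pdivlMr ?exprn_gt0// => gj.
rewrite -(ler_pM2r c0) -mulrA.
apply: (le_trans (ler_wpM2l gap0 kcj)); apply: (le_trans gj).
rewrite /c -!mulrA ler_pM2l//.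
apply: ler_wpM2l; first exact: le_trans hC0.
apply: ler_wpM2l => //.
have le_B : specnorm (Bmat A x) <= Bbound A xs (ls / (4 * L)).
  apply: specnorm_Bmat; rewrite (le_trans (norm2_le_Delta xs x))// lerD2l.
  have L4 : 0 < 4 * L by apply: mulr_gt0.
  by rewrite ler_pdivlMr//; lra.
have Bx0 := specnorm_ge0 (Bmat A x).
by rewrite ler_pXn2r ?nnegrE// (le_trans Bx0).
Qed.

(** Common to both conditions: [stop] enters only through a contraction factor [cr] and a sufficient
    gap threshold [kappa]. Each outer iteration costs at most [Num.sqrt (kappa * c)] inner ones. *)
Lemma total_inner_le (stop : term_cond R m n) (kappa cr : R) (x0 : 'cV[R]_n)
    (x : nat -> 'cV[R]_n) (z : nat -> nat -> 'cV[R]_n)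
    (lam : nat -> nat -> 'cV[R]_m) (eps : R) :
  (forall y w l, good_iterate y -> `|l| <= 1 -> stop y (t y) w l ->
     dF (y + w) <= cr * dF y) ->
  (forall y w l, good_iterate y -> `|l| <= 1 ->
     (Hprimal A b y (t y) w - Ddual A b y (t y) l) * kappa <= t y ->
     stop y (t y) w l) ->
  0 < cr -> cr < 1 -> 0 < kappa -> 1 <= kappa * c ->
  dF x0 <= ls ^+ 2 / (4 * L) -> dF x0 <= ls / (gH * L) ->
  AdaIPL_run A b q G C0 stop x0 x z lam ->
  0 < eps -> eps < D x0 ->
  (total_inner A b xs q G stop x z lam eps <=
   (Num.sqrt (kappa * c) * (ln (2 * D x0 * L * S / (ls * cr) * (1 / eps))
      / ln (1 / cr)))%:E)%E.
Proof.
move=> contr term cr0 cr1 kappa0 kc1 h1 h2 [x00 run] eps0 epsD.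
have D00 := lt_trans eps0 epsD; have [L0 S0] := LS_gt0 D00.
have dF0 y : 0 <= dF y.
  by rewrite (le_trans _ (hsharp y))// mulr_ge0 ?Delta_ge0// ltW.
set K := Keps xs x eps.
have sqrt1 : 1 <= Num.sqrt (kappa * c) by rewrite -sqrtr1 ler_wsqrtr.
have inner k : good_iterate (x k) -> exists j : nat,
    [/\ inner_iters A b q G stop x z lam k = (j%:R)%:E, (1 <= j)%N,
        j%:R <= Num.sqrt (kappa * c) & dF (x k.+1) <= cr * dF (x k)].
  move=> gk; have [_ _ tk _] := gk; have [solve next] := run k tk.
  have [|j [j1 stopj Nj jQ]] := @first_index_bound R
    (fun j => stop (x k) (t (x k)) (z k j) (lam k j)) _ sqrt1.
    move=> j j1 jQ; apply: term => //; first by case: solve.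
    exact: solver_gap.
  exists j; split=> //; rewrite (next j Nj); apply: contr stopj => //.
  by case: solve.
have epsDk k : ((k%:R : R)%:E < K)%E -> eps < D (x k).
  case: k => [|k] kK; first by rewrite x00.
  rewrite ltNge; apply/negP => Dk.
  have kk : (1 <= k.+1 <= k.+1)%N by rewrite leqnn.
  exact: lt_first_index kK kk Dk.
(* Contraction keeps [dF] below its initial value, so the smallness conditions persist; [D (x k)] is
   positive because [eps] has not been reached. *)
have iter k : ((k%:R : R)%:E < K)%E ->
    good_iterate (x k) /\ dF (x k) <= cr ^+ k * dF x0.
  elim: k => [|k IH] kK.
    split; last by rewrite expr0 mul1r x00.
    by rewrite x00; exact: good_iterate_of_gap.
  have [|gk Fk] := IH.
    by apply: lt_trans kK; rewrite lte_fin ltr_nat.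
  have [j [_ _ _ Fk1]] := inner k gk.
  have Fk1' : dF (x k.+1) <= cr ^+ k.+1 * dF x0.
    by rewrite (le_trans Fk1)// exprS -mulrA ler_wpM2l// ltW.
  have F01 : dF (x k.+1) <= dF x0.
    by rewrite (le_trans Fk1')// ler_piMl// exprn_ile1// ltW.
  split=> //; apply: good_iterate_of_gap; rewrite ?(le_trans F01)//.
  exact: lt_trans eps0 (epsDk _ kK).
have lncr : 0 < ln (1 / cr) by rewrite ln_gt0// ltr_pdivlMr// mul1r.
set X := 2 * _ * _ * _ / _ * _.
(* Sharpness gives [ls * eps < dF (x k) <= cr ^+ k * dF x0], and [dF x0 <= 3 / 2 * L * S * D x0].
   The [cr] in the denominator of [X] accounts for [k.+1] in place of [k]. *)
have count k : ((k%:R : R)%:E < K)%E -> k.+1%:R <= ln X / ln (1 / cr).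
  move=> kK; rewrite ler_pdivlMr// mulr_natl -lnXn ?divr_gt0//.
  have [_ Fk] := iter k kK.
  have le_X : (1 / cr) ^+ k.+1 <= X.
    have crk0 : 0 < cr ^+ k.+1 by rewrite exprn_gt0.
    rewrite div1r exprVn /X mulrA mulr1 ler_pdivlMr// mulrC ler_pdivrMr//.
    rewrite mulrAC ler_pdivlMr ?mulr_gt0//.
    have := hsharp (x k); have := ler_wpM2l (ltW hls) (ltW (epsDk k kK)).
    have LD := Delta_le_ls D00 h1; have F0 := Fobj_le_Delta D00 LD.
    have := ler_wpM2l (ltW crk0) F0; have := ler_wpM2l (ltW cr0) Fk.
    rewrite exprS => a1 a2 a3 a4.
    have : 0 <= cr * cr ^+ k * (L * S * D x0).
      rewrite -exprS; apply: mulr_ge0 (ltW crk0) _.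
      exact: mulr_ge0 (mulr_ge0 (ltW L0) (ltW S0)) (ltW D00).
    have := ler_wpM2l (ltW cr0) (le_trans a3 a4); lra.
  have pos1 : 0 < (1 / cr) ^+ k.+1 by rewrite exprn_gt0// divr_gt0.
  by rewrite ler_ln ?posrE// (lt_le_trans pos1).
apply: nneseries_le_count.
- exact: le_trans ler01 sqrt1.
- exact: le_trans ler01 (count 0%N (first_index_gt0 _)).
- move=> k kK; have [gk _] := iter k kK; have [j [-> _ jQ _]] := inner k gk.
  by rewrite !lee_fin jQ ler0n.
- exact: count.
Qed.

End Run.

(** * Contraction factor and closed forms of the inner bounds *)

Section Rates.
Context {R : realType}.
Implicit Types (ls g gH rho : R).

(** The minimum is at most 2, so the subtracted fraction is below 10/16. *)
Lemma Crate_bounds ls g rho : 0 < ls -> 0 < g -> 0 < rho ->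
  0 < Crate ls g rho < 1.
Proof.
move=> ls0 g0 rho0; rewrite /Crate; set mn := Num.min _ _.
have mn0 : 0 < mn by rewrite lt_min mulr_gt0/=.
have mn2 : mn <= 2 by rewrite ge_min lexx orbT.
have den : 0 < 16 * (1 + rho) by rewrite mulr_gt0// addr_gt0.
have h0 : 0 < 5 * mn / (16 * (1 + rho)) by rewrite divr_gt0// mulr_gt0.
have h1 : 5 * mn / (16 * (1 + rho)) < 1 by rewrite ltr_pdivrMr//; lra.
by apply/andP; split; lra.
Qed.

(* The quotient is max(gH, 2 / ls). *)
Lemma max_quotient ls gH (W := gH / Num.min 1 (ls * gH / 2)) :
  0 < ls -> 0 < gH -> [/\ 0 < W, 2 / ls <= W & gH <= W].
Proof.
move=> ls0 gH0; rewrite /W.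
have lg : 0 < ls * gH / 2 by rewrite divr_gt0// mulr_gt0.
case: (leP 1 (ls * gH / 2)) => h.
  by rewrite divr1; split => //; rewrite ler_pdivrMr//; lra.
have -> : gH / (ls * gH / 2) = 2 / ls by field; rewrite !gt_eqF.
by split; rewrite ?divr_gt0// ler_pdivlMr//; lra.
Qed.

Lemma sqrtr_LAC (M ls gH rho T : R) : 0 < ls -> 0 <= M -> 0 < gH -> 0 < rho ->
  Num.sqrt (8 / 5 * (gH / Num.min 1 (ls * gH / 2) / ls) * ((1 + rho) / rho) * M)
  = Num.sqrt (8 / 5 * M) * (Num.sqrt (gH / (ls * Num.min 1 (ls * gH / 2)))
      * Num.sqrt ((1 + rho) / rho)).
Proof.
move=> ls0 M0 gH0 rho0; have [W0 _ _] := max_quotient ls0 gH0.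
have -> : gH / (ls * Num.min 1 (ls * gH / 2)) =
    gH / Num.min 1 (ls * gH / 2) / ls by rewrite invfM; ring.
set W := gH / _ in W0 *.
have -> : 8 / 5 * (W / ls) * ((1 + rho) / rho) * M =
    8 / 5 * M * (W / ls * ((1 + rho) / rho)) by ring.
have W_ls : 0 <= W / ls by rewrite divr_ge0 ?ltW.
by rewrite sqrtrM ?mulr_ge0// (sqrtrM _ W_ls).
Qed.

Lemma sqrtr_HAC (M W rho : R) : 0 <= M -> 0 <= W ->
  Num.sqrt (16 * W ^+ 2 * ((1 + rho) / rho) * M)
  = Num.sqrt (16 * M) * (W * Num.sqrt ((1 + rho) / rho)).
Proof.
move=> M0 W0; have M16 : 0 <= 16 * M by rewrite mulr_ge0.
have -> : 16 * W ^+ 2 * ((1 + rho) / rho) * M =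
    16 * M * W ^+ 2 * ((1 + rho) / rho).
  by ring.
rewrite sqrtrM; last by rewrite mulr_ge0 ?sqr_ge0.
by rewrite sqrtrM// sqrtr_sqr ger0_norm// mulrA.
Qed.

End Rates.

Theorem theorem6p7 (R : realType) (m n : nat) (A : 'M[R]_(m, n))
    (xs : 'cV[R]_n) (b : 'cV[R]_m) (I1 I2 : {set 'I_m})
    (hIU : I1 :|: I2 = [set: 'I_m]%SET) (hID : [disjoint I1 & I2])
    (hb0 : forall i, 0 <= b i 0)
    (hb1 : forall i, i \in I1 -> b i 0 = dotv (datavec A i) xs ^+ 2)
    (ls : R) (hls : 0 < ls)
    (hsharp : forall x : 'cV[R]_n,
       ls * Delta xs x <= Fobj A b x - Fobj A b xs)
    (p : R) (hp0 : 0 < p) (hp1 : p < 1)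
    (q : nat) (hq0 : (0 < q)%N) (hq : m%:R * p = q%:R)
    (uL uH : R) (huL : 0 < uL) (huH : 0 < uH)
    (hr : forall x : 'cV[R]_n,
       uL * (Fobj A b x - Fobj A b xs) <= order_stat q (resid A b x) /\
       order_stat q (resid A b x) <= uH * (Fobj A b x - Fobj A b xs))
    (G : R) (hG : 0 < G) (C0 : R) (hC0 : 2 <= C0) (x0 : 'cV[R]_n) :
  let L := Lconst A in
  let gL := G * ls * uL in
  let gH := 3 / 2 * G * L * norm2 xs * uH in
  let C := Crate ls gL in
  let M1 := Num.sqrt (8 / 5 * C0 * m%:R * Bbound A xs (ls / (4 * L)) ^+ 2) in
  let M2 := Num.sqrt (16 * C0 * m%:R * Bbound A xs (ls / (4 * L)) ^+ 2) in
  Delta xs x0 <= Num.min (Erad A xs (ls ^+ 2 / (4 * L)))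
                         (Erad A xs (ls / (gH * L))) ->
  (forall rho : R, 0 < rho ->
   forall x z lam, AdaIPL_run A b q G C0 (LAC A b rho) x0 x z lam ->
   forall eps : R, 0 < eps -> eps < Delta xs x0 ->
     (total_inner A b xs q G (LAC A b rho) x z lam eps <=
      (M1 * (Num.sqrt (gH / (ls * Num.min 1 (ls * gH / 2)))
             * Num.sqrt ((1 + rho) / rho)
             * ln (2 * Delta xs x0 * L * norm2 xs / (ls * C rho) * (1 / eps))
             / ln (1 / C rho)))%:E)%E)
  /\
  (forall rho : R, 0 < rho -> rho < 1 / 4 ->
   let rhobar := 2 * rho / (1 - 4 * rho) in
   forall x z lam, AdaIPL_run A b q G C0 (HAC A b rho) x0 x z lam ->
   forall eps : R, 0 < eps -> eps < Delta xs x0 ->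
     (total_inner A b xs q G (HAC A b rho) x z lam eps <=
      (M2 * (gH / Num.min 1 (ls * gH / 2)
             * Num.sqrt ((1 + rho) / rho)
             * ln (2 * Delta xs x0 * L * norm2 xs / (ls * C rhobar) * (1 / eps))
             / ln (1 / C rhobar)))%:E)%E).
Proof.
move=> L gL gH C M1 M2; rewrite le_min => /andP[hE1 hE2].
have Delta_x0 eps : 0 < eps -> eps < Delta xs x0 -> 0 < Delta xs x0.
  exact: lt_trans.
pose c := C0 * m%:R * Bbound A xs (ls / (4 * L)) ^+ 2.
have c0 : 0 <= c.
  have C00 : 0 <= C0 by exact: le_trans hC0.
  by rewrite mulr_ge0 ?sqr_ge0// mulr_ge0.
have gL0 : 0 < gL by rewrite /gL !mulr_gt0.
(* Positivity of [L] and [norm2 xs] rests on a point at positive distance, which [eps < Delta xs x0]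
   provides. *)
have init : 0 < Delta xs x0 -> [/\ 0 < gH,
    Fobj A b x0 - Fobj A b xs <= ls ^+ 2 / (4 * L),
    Fobj A b x0 - Fobj A b xs <= ls / (gH * L) & 2 * ls ^+ 2 <= c].
  move=> D0; have [L0 S0] := LS_gt0 hls hsharp D0.
  have gH0 : 0 < gH by do 4!apply: mulr_gt0 => //.
  have r1 : 0 <= ls ^+ 2 / (4 * L).
    by rewrite divr_ge0 ?sqr_ge0//; apply/ltW/mulr_gt0.
  have r2 : 0 <= ls / (gH * L).
    by rewrite divr_ge0 ?(ltW hls)//; apply/ltW/mulr_gt0.
  split=> //; [exact: Erad_Fobj|exact: Erad_Fobj|exact: c_ge D0].
have gap_step y W : gH <= W -> good_iterate A b xs ls q uL uH G y ->
    stepsize A b q G y <= W * Delta xs y.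
  by move=> gW [D0 _ _ [_ tH _]]; rewrite (le_trans tH)// ler_pM2r.
have rr_ge1 (rho : R) : 0 < rho -> 1 <= (1 + rho) / rho.
  by move=> rho0; rewrite ler_pdivlMr//; lra.
have assoc (u v w k : R) : u * (v * w / k) = u * v * (w / k).
  by rewrite !mulrA.
split=> [rho rho0|rho rho0 rho4 rhobar] x z lam run eps eps0 epsD.
- have [gH0 hF1 hF2 hc] := init (Delta_x0 _ eps0 epsD).
  have [] := max_quotient hls gH0; set W := gH / Num.min _ _ => W0 lW gW.
  have lW2 : 2 <= ls * W by rewrite mulrC -ler_pdivrMr.
  have /andP[C_gt0 C_lt1] := Crate_bounds hls gL0 rho0.
  (* The quotient of the two coefficients in [LAC_of_gap]: [(1 + rho) * W] over
     [5 / 8 * ls * rho]. *)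
  pose kappa := 8 / 5 * (W / ls) * ((1 + rho) / rho).
  have c1 : 0 <= 5 / 8 * ls * rho by rewrite !mulr_ge0 ?ltW//; lra.
  have rr := rr_ge1 rho rho0.
  have kappa0 : 0 < kappa.
    apply: mulr_gt0 (lt_le_trans ltr01 rr); apply: mulr_gt0; first by lra.
    exact: divr_gt0 W0 hls.
  have kc1 : 1 <= kappa * c.
    apply: (@le_trans _ _ (kappa * (2 * ls ^+ 2))); last by rewrite ler_pM2l.
    have -> : kappa * (2 * ls ^+ 2) = 16 / 5 * (ls * W) * ((1 + rho) / rho).
      by rewrite /kappa; field; rewrite !gt_eqF.
    rewrite -[leLHS]mulr1; apply: ler_pM => //; lra.
  have kE : Num.sqrt (kappa * c) =
      M1 * (Num.sqrt (gH / (ls * Num.min 1 (ls * gH / 2)))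
            * Num.sqrt ((1 + rho) / rho)).
    by rewrite sqrtr_LAC// /M1 /c !mulrA.
  rewrite assoc -kE.
  apply: (total_inner_le hls hsharp huL huH hG hC0 hr) run eps0 epsD => //.
  + move=> y w l [D0 LD t0 [gt _ tL]] l1.
    exact: (LAC_contraction hls hsharp t0 l1 D0 LD rho0 gL0 gt tL).
  + move=> y w l gy l1 gapk; have tW := gap_step y W gW gy.
    case: gy => [D0 LD t0 _].
    apply: (LAC_of_gap hls hsharp t0 l1 D0 LD rho0 lW tW).
    have := ler_wpM2r c1 gapk; congr (_ <= _).
      by rewrite /kappa; field; rewrite !gt_eqF.
    by ring.
- have [gH0 hF1 hF2 hc] := init (Delta_x0 _ eps0 epsD).
  have [] := max_quotient hls gH0; set W := gH / Num.min _ _ => W0 lW gW.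
  have lW2 : 2 <= ls * W by rewrite mulrC -ler_pdivrMr.
  have rhobar0 : 0 < rhobar by rewrite divr_gt0// ?mulr_gt0//; lra.
  have /andP[C_gt0 C_lt1] := Crate_bounds hls gL0 rhobar0.
  (* The gap coefficient in [HAC_of_gap] divided by [rho]. *)
  pose kappa := 16 * W ^+ 2 * ((1 + rho) / rho).
  have rr := rr_ge1 rho rho0.
  have kappa0 : 0 < kappa.
    apply: mulr_gt0 (lt_le_trans ltr01 rr); apply: mulr_gt0 => //.
    exact: exprn_gt0 W0.
  have kc1 : 1 <= kappa * c.
    apply: (@le_trans _ _ (kappa * (2 * ls ^+ 2))); last by rewrite ler_pM2l.
    have -> : kappa * (2 * ls ^+ 2) = 32 * (ls * W) ^+ 2 * ((1 + rho) / rho).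
      by rewrite /kappa; ring.
    have lW4 : 2 ^+ 2 <= (ls * W) ^+ 2.
      by rewrite ler_pXn2r ?nnegrE// mulr_ge0 ?ltW.
    rewrite -[leLHS]mulr1; apply: ler_pM => //; lra.
  have kE : Num.sqrt (kappa * c) = M2 * (W * Num.sqrt ((1 + rho) / rho)).
    by rewrite sqrtr_HAC ?(ltW W0)// /M2 /c !mulrA.
  rewrite assoc -kE.
  apply: (total_inner_le hls hsharp huL huH hG hC0 hr) run eps0 epsD => //.
  (* Contraction goes through (LAC) with [rhobar]; termination is shown for (HAC) itself, with
     [rho]. *)
  + move=> y w l [D0 LD t0 [gt _ tL]] l1 hac.
    apply: (LAC_contraction hls hsharp t0 l1 D0 LD rhobar0 gL0 gt tL).
    exact: LAC_of_HAC.
  + move=> y w l gy l1 gapk; have tW := gap_step y W gW gy.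
    case: gy => [D0 LD t0 [_ _ tL]].
    apply: (HAC_of_gap hls hsharp t0 l1 D0 LD rho0 rho4 tL lW tW).
    have := ler_wpM2r (ltW rho0) gapk; congr (_ <= _); last exact: mulrC.
    by rewrite /kappa; field; rewrite gt_eqF.
Qed.
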